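(* Let $S = \mathcal{M}[G;I,\Lambda;P]$ be a Rees matrix semigroup over a DSC group $G$. Then the maps $\rho \mapsto (N_\rho, \rho_I, \rho_\Lambda)$ (from the set of diagonal subsemigroups on $S$ to the set of linked reflexive triples) and $(N,\mathcal{S},\mathcal{T}) \mapsto \rho_{N,\mathcal{S},\mathcal{T}}$ (from the set of linked reflexive triples to the set of diagonal subsemigroups on $S$) are mutually inverse, and so give a one-to-one correspondence between the diagonal subsemigroups on $S$ and the linked reflexive triples.
   Context: Let $G$ be a group with identity $1$, $I$ and $\Lambda$ non-empty sets, and $P = (p_{\lambda i})_{\lambda \in \Lambda, i \in I}$ a $\Lambda \times I$ matrix with entries from $G$. The Rees matrix semigroup $\mathcal{M}[G;I,\Lambda;P]$ is the set $I \times G \times \Lambda$ with multiplication $(i,g,\lambda)(j,h,\mu) = (i, g p_{\lambda j} h, \mu)$. A diagonal subsemigroup on a semigroup $T$ is a reflexive relation $\rho$ on $T$ that is compatible: $(x,y),(z,t) \in \rho$ implies $(xz,yt) \in \rho$. A congruence is a compatible equivalence relation. A semigroup (in particular a group) is DSC if every diagonal subsemigroup on it is a congruence. For $i,j \in I$, $\lambda,\mu \in \Lambda$, the extract is $q_{\lambda\mu i j} = p_{\lambda i} p_{\mu i}^{-1} p_{\mu j} p_{\lambda j}^{-1}$. A triple $(N,\mathcal{S},\mathcal{T})$ consists of a normal subgroup $N$ of $G$, a relation $\mathcal{S}$ on $I$ and a relation $\mathcal{T}$ on $\Lambda$. It is linked if for all $i,j \in I$ and $\lambda,\mu \in \Lambda$: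 $(i,j) \in \mathcal{S}$ implies $q_{\lambda\mu i j} \in N$, and $(\lambda,\mu) \in \mathcal{T}$ implies $q_{\lambda\mu i j} \in N$. A linked reflexive triple is a linked triple in which $\mathcal{S}$ and $\mathcal{T}$ are reflexive. For a relation $\rho$ on $S$ define $N_\rho = \{ g \in G : (i,g,\lambda) \,\rho\, (i,1,\lambda) \text{ for all } i \in I, \lambda \in \Lambda\}$, $\rho_I = \{(i,j) \in I \times I : (i,p_{\lambda i}^{-1},\lambda) \,\rho\, (j,p_{\lambda j}^{-1},\lambda) \text{ for all } \lambda \in \Lambda\}$, $\rho_\Lambda = \{(\lambda,\mu) \in \Lambda \times \Lambda : (i,p_{\lambda i}^{-1},\lambda) \,\rho\, (i,p_{\mu i}^{-1},\mu) \text{ for all } i \in I\}$. For a triple $(N,\mathcal{S},\mathcal{T})$ define the relation $\rho_{N,\mathcal{S},\mathcal{T}}$ on $S$ by: $(i,g,\lambda) \,\rho_{N,\mathcal{S},\mathcal{T}}\, (j,h,\mu)$ if and only if $(i,j) \in \mathcal{S}$, $(\lambda,\mu) \in \mathcal{T}$, and $p_{\nu i}\, g\, p_{\lambda k} p_{\mu k}^{-1} h^{-1} p_{\nu j}^{-1} \in N$ for all $k \in I$ and $\nu \in \Lambda$. *)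

(* Defs.v *)
From HB Require Import structures.
From Corelib Require Export RelationClasses Relation_Definitions.
From mathcomp Require Export all_boot.
From mathcomp Require Export boolp classical_sets functions.

Set Implicit Arguments.
Unset Strict Implicit.
Unset Printing Implicit Defensive.

Local Open Scope group_scope.

Section Relations.
Variable T : semigroupType.
Implicit Type rho : relation T.

Definition compatible rho : Prop :=
  forall x y z t : T, rho x y -> rho z t -> rho (x * z) (y * t).

Definition diagonal_subsemigroup rho : Prop :=
  Reflexive rho /\ compatible rho.

Definition congruence rho : Prop :=
  Equivalence rho /\ compatible rho.

Definition DSC : Prop :=
  forall rho, diagonal_subsemigroup rho -> congruence rho.

End Relations.

Definition normal_subgroup (G : groupType) (N : set G) : Prop :=
  [/\ N 1,
      forall x y, N x -> N y -> N (x * y),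
      forall x, N x -> N x^-1
    & forall x g, N x -> N (x ^ g)].

(* [rees P] depends on [P] because its multiplication does. *)
Record rees (G : groupType) (I L : Type) (P : L -> I -> G) :=
  Rees { rees_I : I; rees_G : G; rees_L : L }.
Arguments Rees {G I L} P.

Section ReesMatrixSemigroup.
Variables (G : groupType) (I L : Type) (P : L -> I -> G).
Local Notation S := (rees P).
Local Notation elt := (Rees P).

Definition rees_mul (x y : S) : S :=
  elt (rees_I x) (rees_G x * P (rees_L x) (rees_I y) * rees_G y) (rees_L y).

Lemma rees_mulA : associative rees_mul.
Proof. by move=> [i g l] [j h m] [k a n]; rewrite /rees_mul /= !mulgA. Qed.

HB.instance Definition _ := gen_eqMixin S.
HB.instance Definition _ := gen_choiceMixin S.
HB.instance Definition _ := isSemigroup.Build S rees_mulA.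

Definition extract (l m : L) (i j : I) : G :=
  P l i * (P m i)^-1 * P m j * (P l j)^-1.

(* The normality of the first component is not part of this type; it is imposed
   by [linked]. *)
Record triple := Triple {
  triple_N : set G;
  triple_I : relation I;
  triple_L : relation L }.

Definition linked (t : triple) : Prop :=
  [/\ normal_subgroup (triple_N t),
      forall i j l m, triple_I t i j -> triple_N t (extract l m i j)
    & forall i j l m, triple_L t l m -> triple_N t (extract l m i j)].

Definition linked_reflexive (t : triple) : Prop :=
  [/\ linked t, Reflexive (triple_I t) & Reflexive (triple_L t)].

Definition triple_of_rel (rho : relation S) : triple :=
  Triple
    (fun g => forall i l, rho (elt i g l) (elt i 1 l))
    (fun i j => forall l, rho (elt i (P l i)^-1 l) (elt j (P l j)^-1 l))
    (fun l m => forall i, rho (elt i (P l i)^-1 l) (elt i (P m i)^-1 m)).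

Definition rel_of_triple (t : triple) : relation S := fun x y =>
  let: Rees i g l := x in let: Rees j h m := y in
  [/\ triple_I t i j, triple_L t l m
    & forall k n, triple_N t
        (P n i * g * P l k * (P m k)^-1 * h^-1 * (P n j)^-1)].

End ReesMatrixSemigroup.

(* Main.v *)
Require Import Defs.

(** Let [rho] be a diagonal subsemigroup on a Rees matrix semigroup over a DSC
    group [G].  Multiplying on both sides by arbitrary elements carries a pair
    of [rho] lying in one fibre [{i} x G x {l}] to any other fibre, so [rho]
    restricts to the same relation on every fibre ([fibre_relP]).  This common
    relation is a diagonal subsemigroup on [G]
    ([fibre_diagonal_subsemigroup]), hence a congruence since [G] is DSC.  So
    [N_rho] is a normal subgroup ([triple_N_normal]) and the relation is
    congruence modulo [N_rho] ([fibre_relE]).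

    It remains to see that [rho] is determined by its restriction to a fibre
    and by the pairs of idempotents [(i, (P l i)^-1, l)] that it relates
    ([rel_of_tripleK]).  The condition defining [rel_of_triple] says that
    [P n i * g * P l k] and [P n j * h * P m k] agree modulo [N] for all [k]
    and [n] ([rel_of_tripleE]); these words are the middle coordinates obtained
    by multiplying [(i, g, l)] and [(j, h, m)] into the fibre of [(k, n)].  A
    pair of [rho] yields a pair of idempotents, up to a correction modulo [N]
    ([rel_eqmodr], [rel_eqmodl]), when it is multiplied by the inverses of these
    words, and conversely the pair is recovered by placing a pair from a fibre
    between a pair of idempotents with equal [L]-indices and a pair with equal
    [I]-indices.

    Starting from a triple, the middle-coordinate condition is compatible
    because two words agreeing modulo [N] may be replaced one after the other
    ([rel_of_triple_diagonal]).  On idempotents it is, up to conjugation, the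
    condition on extracts in the definition of a linked triple, which is why
    linked triples are recovered ([triple_of_relK]). *)

Set Implicit Arguments.
Unset Strict Implicit.
Unset Printing Implicit Defensive.

Local Open Scope group_scope.

(* These rules reduce a group word to a left-associated one in which adjacent
   inverse letters are cancelled. *)
Local Notation cancelg := (invgM, invgK, invg1, mulgA, mulgK, mulgVK, mulgV,
  mulVg, mul1g, mulg1).

(** * Congruence modulo a normal subgroup *)

Section EqMod.
Variables (G : groupType) (N : set G).

Definition eqmod (x y : G) : Prop := N (x * y^-1).

Hypothesis normN : normal_subgroup N.

Lemma eqmod_refl x : eqmod x x.
Proof. by case: normN => N1 _ _ _; rewrite /eqmod mulgV. Qed.

Lemma eqmod_sym x y : eqmod x y -> eqmod y x.
Proof. by case: normN => _ _ NV _ /NV; rewrite /eqmod !cancelg. Qed.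

Lemma eqmod_trans y x z : eqmod x y -> eqmod y z -> eqmod x z.
Proof. by case: normN => _ NM _ _ xy /(NM _ _ xy); rewrite /eqmod !cancelg. Qed.

Lemma eqmod_mulr a x y : eqmod x y -> eqmod (x * a) (y * a).
Proof. by rewrite /eqmod !cancelg. Qed.

Lemma eqmod_mull a x y : eqmod x y -> eqmod (a * x) (a * y).
Proof.
by case: normN => _ _ _ NJ /(NJ _ a^-1); rewrite /eqmod /conjg !cancelg.
Qed.

Lemma eqmod_mul2 a b x y : eqmod x y -> eqmod (a * x * b) (a * y * b).
Proof. by move=> xy; apply/eqmod_mulr/eqmod_mull. Qed.

End EqMod.

Section ReesDiagonal.
Variables (G : groupType) (I L : Type) (P : L -> I -> G).
Local Notation S := (rees P).
Local Notation elt := (Rees P).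

Implicit Types (i j k : I) (l m n : L) (t : triple G I L) (rho : relation S).

Lemma rees_mulE i g l j h m :
  elt i g l * elt j h m = elt i (g * P l j * h) m.
Proof. by []. Qed.

Lemma triple_ext t t' :
  (forall g, triple_N t g <-> triple_N t' g) ->
  (forall i j, triple_I t i j <-> triple_I t' i j) ->
  (forall l m, triple_L t l m <-> triple_L t' l m) -> t = t'.
Proof.
case: t t' => [N A B] [N' A' B'] /= eqN eqA eqB.
congr Triple; first by apply/funext => g; apply/propext.
  by apply/funext => i; apply/funext => j; apply/propext.
by apply/funext => l; apply/funext => m; apply/propext.
Qed.

(** * From triples to diagonal subsemigroups *)

Lemma rel_of_tripleE t i g l j h m :
  rel_of_triple t (elt i g l) (elt j h m) <->
  [/\ triple_I t i j, triple_L t l m &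
      forall k n, eqmod (triple_N t) (P n i * g * P l k) (P n j * h * P m k)].
Proof.
by split=> -[ij lm H]; split=> // k n; move: (H k n); rewrite /eqmod !cancelg.
Qed.

(** In a product the new middle coordinate is [g * P l i' * g'].  The word for
    the second factor replaces [P l i' * g' * P l' k] by [P l j' * h' * P m' k],
    which leaves the word for the first factor ending in [P l j']. *)
Lemma rel_of_triple_diagonal t :
  linked_reflexive P t -> diagonal_subsemigroup (@rel_of_triple G I L P t).
Proof.
case=> -[normN _ _] reflI reflL; split.
  move=> [i g l]; apply/rel_of_tripleE.
  by split=> // k n; apply: eqmod_refl.
move=> [i g l] [j h m] [i' g' l'] [j' h' m'].
move=> /rel_of_tripleE[ij lm gh] /rel_of_tripleE[ij' lm' gh'].
apply/rel_of_tripleE; split=> //= k n.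
apply: (eqmod_trans normN (y := P n i * g * P l j' * h' * P m' k)).
  by have := eqmod_mull normN (P n i * g) (gh' k l); rewrite !cancelg.
by have := eqmod_mulr (h' * P m' k) (gh j' n); rewrite !cancelg.
Qed.

Lemma triple_of_relK t :
  inhabited I -> inhabited L -> linked_reflexive P t ->
  triple_of_rel (@rel_of_triple G I L P t) = t.
Proof.
case=> i0 [l0] [[normN linkI linkL] reflI reflL]; apply: triple_ext => /=.
- move=> g; split=> [/(_ i0 l0)/rel_of_tripleE[_ _ /(_ i0 l0) gw]|Ng i l].
    have := eqmod_mul2 normN (P l0 i0)^-1 (P l0 i0)^-1 gw.
    by rewrite /eqmod !cancelg.
  apply/rel_of_tripleE; split=> // k n; apply: eqmod_mul2 => //.
  by rewrite /eqmod !cancelg.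
- move=> i j; split=> [/(_ l0)[]//|ij l].
  apply/rel_of_tripleE; split=> // k n; apply: eqmod_mulr.
  by have := linkI i j n l ij; rewrite /extract /eqmod !cancelg.
- move=> l m; split=> [/(_ i0)[]//|lm i].
  apply/rel_of_tripleE; split=> // k n; rewrite -!mulgA; apply: eqmod_mull => //.
  (* The word to obtain is the extract with indices [k] and [i], conjugated by
     [P l i]. *)
  have link : eqmod (triple_N t) (P l k * (P m k)^-1 * P m i) (P l i).
    exact: linkL.
  have := eqmod_mul2 normN (P l i)^-1 ((P m i)^-1 * P m k) link.
  by rewrite !cancelg.
Qed.

(** * The relation induced on the fibres *)

(** The class of [1] for this relation is [N_rho]: by definition
    [triple_N (triple_of_rel rho) g] is [fibre_rel rho g 1]. *)
Definition fibre_rel rho (x y : G) : Prop :=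
  forall i l, rho (elt i x l) (elt i y l).

Section Diagonal.
Variable rho : relation S.
Hypothesis diag : diagonal_subsemigroup rho.

Let N := triple_N (triple_of_rel rho).

(** Multiplication by elements with arbitrary indices moves a pair out of its
    fibre into any other one, and the group coordinates of the multipliers can
    absorb the matrix entries that arise. *)
Lemma fibre_relP a b i l x y :
  rho (elt i x l) (elt i y l) -> fibre_rel rho (a * x * b) (a * y * b).
Proof.
move=> xy j m; case: diag => refl comp.
have := comp _ _ _ _ (refl (elt j (a * (P m i)^-1) m)) xy.
move=> /comp /(_ (refl (elt j ((P l j)^-1 * b) m))).
by rewrite !rees_mulE !cancelg.
Qed.

Lemma fibre_diagonal_subsemigroup : diagonal_subsemigroup (fibre_rel rho).
Proof.
case: diag => refl comp; split=> [x i l //|x y z t xy zt i l].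
have := fibre_relP (P l i)^-1 1 (zt i l).
move=> /(_ i l) /(comp _ _ _ _ (xy i l)).
by rewrite !rees_mulE !cancelg.
Qed.

(** Reflexivity and compatibility alone allow a pair to be translated by [y] and
    by [y^-1], so the relation is determined by the elements related to [1]. *)
Lemma fibre_relE x y : fibre_rel rho x y <-> eqmod N x y.
Proof.
have [refl comp] := fibre_diagonal_subsemigroup.
split=> xy; last by have := comp _ _ _ _ xy (refl y); rewrite !cancelg.
by have := comp _ _ _ _ xy (refl y^-1); rewrite mulgV.
Qed.

Hypothesis dscG : DSC G.

(** Here the hypothesis on [G] provides the inverses, by symmetry. *)
Lemma triple_N_normal : normal_subgroup N.
Proof.
have [[refl sym _] comp] := dscG fibre_diagonal_subsemigroup.
split; first exact: refl.
- by move=> x y Nx Ny; have := comp _ _ _ _ Nx Ny; rewrite mulg1.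
- by move=> x Nx; have := comp _ _ _ _ (refl x^-1) (sym _ _ Nx); rewrite !cancelg.
- move=> x g Nx; have := comp _ _ _ _ (refl g^-1) (comp _ _ _ _ Nx (refl g)).
  by rewrite !cancelg /N /fibre_rel /= /conjg !cancelg.
Qed.

Let normN := triple_N_normal.

(** Multiplying a pair of [rho] on both sides by [(k, 1, n)] lands in the fibre
    of [(k, n)]. *)
Lemma rel_eqmod i g l j h m k n :
  rho (elt i g l) (elt j h m) ->
  eqmod N (P n i * g * P l k) (P n j * h * P m k).
Proof.
move=> gh; apply: (fibre_relE _ _).1; case: diag => refl comp.
have := comp _ _ _ _ (comp _ _ _ _ (refl (elt k 1 n)) gh) (refl (elt k 1 n)).
rewrite !rees_mulE !cancelg => /(fibre_relP 1 1).
by rewrite !cancelg.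
Qed.

(** With a common last index [n], right multiplication by elements of the form
    [(j, (P n j)^-1 * w, n)] acts on the middle coordinate by [w], so one side
    of a pair can be changed modulo [N] while the other is kept. *)
Lemma rel_eqmodr i x j y z n :
  rho (elt i x n) (elt j y n) -> eqmod N y z -> rho (elt i x n) (elt j z n).
Proof.
move=> xy /(eqmod_mull normN ((P n j)^-1 * y^-1)); rewrite !cancelg.
move=> /(fibre_relE _ _).2 /(_ j n) /(proj2 diag _ _ _ _ xy).
by rewrite !rees_mulE !cancelg.
Qed.

Lemma rel_eqmodl l x m y z k :
  rho (elt k x l) (elt k y m) -> eqmod N y z -> rho (elt k x l) (elt k z m).
Proof.
move=> xy /(eqmod_mulr (y^-1 * (P l k)^-1)); rewrite !cancelg.
move=> /(fibre_relE _ _).2 /(_ k l) /(proj2 diag) /(_ xy).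
by rewrite !rees_mulE !cancelg.
Qed.

(** * From diagonal subsemigroups to triples *)

Lemma triple_of_rel_linked : linked_reflexive P (triple_of_rel rho).
Proof.
have [refl _] := diag; split; [split=> // | |]; try by move=> x y; apply: refl.
  move=> i j l m /(_ m) /rel_eqmod -/(_ j l).
  by rewrite /eqmod /extract !cancelg.
move=> i j l m /(_ i) /rel_eqmod -/(_ j l) /(eqmod_sym normN).
by rewrite /eqmod /extract !cancelg.
Qed.

Lemma rel_of_tripleK : rel_of_triple (triple_of_rel rho) = rho.
Proof.
have [refl comp] := diag.
apply/funext => -[i g l]; apply/funext => -[j h m]; apply/propext.
split=> [/rel_of_tripleE[/= ij lm gh]|gh].
  (* A pair in the fibre of [(i, l)] is placed between the idempotents with last
     index [l] and those with first index [i]; its coordinates are chosen so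
     that the two products are the given elements. *)
  have ab : eqmod N ((P l i)^-1 * (P l i * g * P l i) * (P l i)^-1)
                    ((P l i)^-1 * (P l j * h * P m i) * (P l i)^-1).
    exact: eqmod_mul2 (gh i l).
  have /(fibre_relE _ _).2/(_ i l) := ab.
  move=> /(comp _ _ _ _ (ij l)) /comp /(_ (lm i)).
  by rewrite !rees_mulE !cancelg.
have word k n := rel_eqmod k n gh.
apply/rel_of_tripleE; split=> //= [n|k].
  (* The chosen multiplier makes the left-hand product idempotent, and the
     right-hand one an idempotent modulo [N]. *)
  have := comp _ _ _ _ gh (refl (elt i ((g * P l i)^-1 * (P n i)^-1) n)).
  rewrite !rees_mulE !cancelg => /rel_eqmodr; apply.
  have := eqmod_mul2 normN (P n j)^-1 ((P n i * g * P l i)^-1) (word i n).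
  by rewrite !cancelg => /(eqmod_sym normN).
have := comp _ _ _ _ (refl (elt k ((P l k)^-1 * (P l i * g)^-1) l)) gh.
rewrite !rees_mulE !cancelg => /rel_eqmodl; apply.
have := eqmod_mul2 normN ((P l i * g * P l k)^-1) (P m k)^-1 (word k l).
by rewrite !cancelg => /(eqmod_sym normN).
Qed.

End Diagonal.
End ReesDiagonal.

(** * The correspondence *)

Theorem theorem2p7 (G : groupType) (I L : Type) (P : L -> I -> G) :
  inhabited I -> inhabited L -> DSC G ->
  let diags : set (relation (rees P)) :=
    [set rho | diagonal_subsemigroup rho]%classic in
  let triples : set (triple G I L) := [set t | linked_reflexive P t]%classic in
  [/\ set_fun diags triples (@triple_of_rel G I L P),
      set_fun triples diags (@rel_of_triple G I L P),
      {in diags, cancel (@triple_of_rel G I L P) (@rel_of_triple G I L P)},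
      {in triples, cancel (@rel_of_triple G I L P) (@triple_of_rel G I L P)}
    & set_bij diags triples (@triple_of_rel G I L P)].
Proof.
move=> inhI inhL dscG diags triples.
have funT : set_fun diags triples (@triple_of_rel G I L P).
  by move=> rho diag; apply: triple_of_rel_linked.
have funR : set_fun triples diags (@rel_of_triple G I L P).
  by move=> t; apply: rel_of_triple_diagonal.
have cancelT : {in diags, cancel (@triple_of_rel G I L P) (@rel_of_triple G I L P)}.
  by move=> rho /set_mem diag; apply: rel_of_tripleK.
have cancelR : {in triples, cancel (@rel_of_triple G I L P) (@triple_of_rel G I L P)}.
  by move=> t /set_mem linked_t; apply: triple_of_relK.
split=> //; split=> //; first exact: can_in_inj cancelT.
move=> t linked_t; exists (rel_of_triple t); first exact: funR.
by apply: cancelR; apply: mem_set.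
Qed.
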